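(* Let $p,q$ be integers with $2\leq p\leq q$. Then the $(p,q)$-torus link Artin monoid $A_{p,q}$ is a Garside monoid, with Garside element $$\Delta=(x_1x_2\cdots x_p)^{\frac{q}{\gcd(p,q)}} .$$
   Context: Definition of $A_{p,q}$, for $2\leq p\leq q$: it is the monoid generated by $x_1,\dots,x_p$ subject to the following relations. If $p$ divides $q$, say $q=pk$: $(x_1x_2\cdots x_p)^k=(x_2\cdots x_p x_1)^k=\cdots=(x_p x_1\cdots x_{p-1})^k$. If $p$ does not divide $q$, write $q=p\alpha+\beta$ with $\alpha=\lfloor q/p\rfloor$ and $1\leq\beta\leq p-1$; the relations are $$(x_1\cdots x_p)^{\alpha+1}=(x_e x_{e+1}\cdots x_p)(x_1\cdots x_p)^{\alpha}\,x_{p-\beta+1}x_{p-\beta+2}\cdots x_{p-\beta+e-1}\quad\text{for }2\leq e\leq\beta,$$ $$(x_1\cdots x_p)^{\alpha}\,x_j=x_{\beta+j}\,(x_1\cdots x_p)^{\alpha}\quad\text{for }1\leq j\leq p-\beta .$$ In a monoid $M$: $b$ is a left divisor of $a$ (and $a$ is a right multiple of $b$) if $a=bd$ for some $d\in M$; right divisors and left multiples are defined symmetrically. An element $c$ is a right lcm of $a$ and $b$ if it is a right multiple of both and every common right multiple of $a$ and $b$ is a right multiple of $c$; left lcm is defined symmetrically. $M$ is conical if $1$ is its only invertible element. A Garside element of $M$ is an element whose set of left divisors coincides with its set of right divisors and generates $M$. $M$ is a Garside monoid if it is conical and (left and right) cancellative, every pair of elements admits a left lcm and a right lcm, and $M$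 admits a Garside element. *)

(* Defs.v *)
From HB Require Import structures.
From mathcomp Require Import all_boot boolp.

Set Implicit Arguments.
Unset Strict Implicit.
Unset Printing Implicit Defensive.

Local Open Scope quotient_scope.
Local Open Scope group_scope.

Section Divisibility.
Variable M : monoidType.
Implicit Types a b c d : M.

Definition left_divisor b a := exists d, a = b * d.
Definition right_divisor b a := exists d, a = d * b.
Definition right_multiple a b := left_divisor b a.
Definition left_multiple a b := right_divisor b a.

Definition is_right_lcm c a b :=
  [/\ right_multiple c a, right_multiple c b &
      forall m, right_multiple m a -> right_multiple m b -> right_multiple m c].

Definition is_left_lcm c a b :=
  [/\ left_multiple c a, left_multiple c b &
      forall m, left_multiple m a -> left_multiple m b -> left_multiple m c].

Definition invertible a := exists b, a * b = 1 /\ b * a = 1.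

Definition generates (S : M -> Prop) :=
  forall a, exists2 s : seq M, {in s, forall x, S x} & a = \prod_(x <- s) x.

Definition garside_element c :=
  (forall a, left_divisor a c <-> right_divisor a c) /\
  generates (fun a => left_divisor a c).

End Divisibility.

Definition conical (M : monoidType) := forall a : M, invertible a -> a = 1.

Definition left_cancellative (M : monoidType) :=
  forall a b c : M, a * b = a * c -> b = c.

Definition right_cancellative (M : monoidType) :=
  forall a b c : M, b * a = c * a -> b = c.

Record garside_monoid (M : monoidType) : Prop := GarsideMonoid {
  garside_conical : conical M;
  garside_left_cancellative : left_cancellative M;
  garside_right_cancellative : right_cancellative M;
  garside_left_lcm : forall a b : M, exists c, is_left_lcm c a b;
  garside_right_lcm : forall a b : M, exists c, is_right_lcm c a b;
  garside_has_element : exists c : M, garside_element c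
}.

Section Presentation.
Variables (X : choiceType) (R : seq X -> seq X -> Prop).
Implicit Types u v w : seq X.

(* The least congruence on the free monoid [seq X] containing [R]. *)
Inductive pres_cong : seq X -> seq X -> Prop :=
| pres_cong_rel u v : R u v -> pres_cong u v
| pres_cong_refl u : pres_cong u u
| pres_cong_sym u v : pres_cong u v -> pres_cong v u
| pres_cong_trans v u w : pres_cong u v -> pres_cong v w -> pres_cong u w
| pres_cong_cat u u' v v' :
    pres_cong u u' -> pres_cong v v' -> pres_cong (u ++ v) (u' ++ v').

(* [{eq_quot _}] needs a boolean relation, hence the classical [`[< _ >]]. *)
Definition pres_congb : rel (seq X) := fun u v => `[< pres_cong u v >].

Lemma pres_congb_refl : reflexive pres_congb.
Proof. by move=> u; apply/asboolP; exact: pres_cong_refl. Qed.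

Lemma pres_congb_sym : symmetric pres_congb.
Proof. by move=> u v; apply/asboolP/asboolP; exact: pres_cong_sym. Qed.

Lemma pres_congb_trans : transitive pres_congb.
Proof.
move=> v u w /asboolP uv /asboolP vw; apply/asboolP.
exact: pres_cong_trans uv vw.
Qed.

Canonical pres_cong_equiv :=
  EquivRel pres_congb pres_congb_refl pres_congb_sym pres_congb_trans.

Definition presented_monoid : Type := {eq_quot pres_congb}.

HB.instance Definition _ := Choice.on presented_monoid.

Definition pres_class u : presented_monoid := \pi_{eq_quot pres_congb} u.
Definition pres_repr (a : presented_monoid) : seq X :=
  repr (a : {eq_quot pres_congb}).

Definition pres_one : presented_monoid := pres_class [::].
Definition pres_mul (a b : presented_monoid) : presented_monoid :=
  pres_class (pres_repr a ++ pres_repr b).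

Lemma pres_reprK : cancel pres_repr pres_class.
Proof. exact: reprK. Qed.

Lemma pres_class_eq u v : pres_class u = pres_class v <-> pres_cong u v.
Proof. by split=> [/eqmodP/asboolP|uv]; [|apply/eqmodP/asboolP]. Qed.

Lemma pres_class_cat u v :
  pres_mul (pres_class u) (pres_class v) = pres_class (u ++ v).
Proof.
by apply/pres_class_eq/pres_cong_cat; apply/pres_class_eq; exact: pres_reprK.
Qed.

Lemma pres_mulA : associative pres_mul.
Proof.
move=> a b c; rewrite -[a]pres_reprK -[b]pres_reprK -[c]pres_reprK.
by rewrite !pres_class_cat catA.
Qed.

Lemma pres_mul1 : left_id pres_one pres_mul.
Proof. by move=> a; rewrite -[a]pres_reprK pres_class_cat. Qed.

Lemma pres_mulr1 : right_id pres_one pres_mul.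
Proof. by move=> a; rewrite -[a]pres_reprK pres_class_cat cats0. Qed.

HB.instance Definition _ :=
  isMonoid.Build presented_monoid pres_mulA pres_mul1 pres_mulr1.

End Presentation.

Section TorusLinkArtinMonoid.
Variables p q : nat.

(* The word x_a x_(a+1) ... x_b. The generators x_1, ..., x_p are numbered from
   1, so that x_n is the letter [i : 'I_p] with [i.+1 = n]; the word is empty if
   [b < a]. *)
Definition xword (a b : nat) : seq 'I_p :=
  [seq i : 'I_p <- enum 'I_p | (a <= i.+1 <= b)%N].

Lemma xwordE a b : (0 < a)%N -> (b <= p)%N ->
  [seq (val i).+1 | i : 'I_p <- xword a b] = iota a (b.+1 - a).
Proof.
move=> a0 bp; rewrite /xword.
have -> : [seq (val i).+1 | i : 'I_p <-
             [seq i : 'I_p <- enum 'I_p | (a <= i.+1 <= b)%N]]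
   = [seq n <- iota 1 p | (a <= n <= b)%N].
  by rewrite -[1%N]addn0 iotaDl -val_enum_ord -map_comp [RHS]filter_map.
apply: (sorted_eq leq_trans anti_leq).
- exact: (sorted_filter leq_trans _ (iota_sorted 1 p)).
- exact: iota_sorted.
apply: uniq_perm; rewrite ?filter_uniq ?iota_uniq // => n.
rewrite mem_filter !mem_iota.
case: (leqP a n) => //= an.
case: (leqP a b.+1) => ab.
  rewrite subnKC // add1n !ltnS (leq_trans a0 an) /=.
  by case: leqP => //= nb; exact: leq_trans nb bp.
rewrite (eqP (ltnW ab : b.+1 - a == 0)) addn0.
by rewrite [(n <= b)%N]leqNgt (leq_trans (ltnW ab) an) /= ltnNge an.
Qed.

Definition word_exp (w : seq 'I_p) (n : nat) : seq 'I_p := flatten (nseq n w).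

Inductive torus_rel : seq 'I_p -> seq 'I_p -> Prop :=
| torus_rel_dvd i of p %| q & (2 <= i <= p)%N :
    torus_rel (word_exp (xword 1 p) (q %/ p))
              (word_exp (xword i p ++ xword 1 i.-1) (q %/ p))
| torus_rel_power e of ~~ (p %| q) & (2 <= e <= q %% p)%N :
    torus_rel (word_exp (xword 1 p) (q %/ p).+1)
              (xword e p ++ word_exp (xword 1 p) (q %/ p) ++
               xword (p - q %% p + 1) (p - q %% p + e - 1))
| torus_rel_shift j of ~~ (p %| q) & (1 <= j <= p - q %% p)%N :
    torus_rel (word_exp (xword 1 p) (q %/ p) ++ xword j j)
              (xword (q %% p + j) (q %% p + j) ++
               word_exp (xword 1 p) (q %/ p)).

Definition torus_monoid := presented_monoid torus_rel.

(* [torus_gen i] is x_(i+1). *)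
Definition torus_gen (i : 'I_p) : torus_monoid := pres_class torus_rel [:: i].

End TorusLinkArtinMonoid.

(* Main.v *)
Require Import Defs.
From HB Require Import structures.
From mathcomp Require Import all_boot boolp zify.

Set Implicit Arguments.
Unset Strict Implicit.
Unset Printing Implicit Defensive.

Local Open Scope group_scope.

(** Write [c = x_1 ... x_p], [alpha = q %/ p] and [beta = q %% p]. The whole
    Garside structure can be read off the shape of the presentation: for each
    [2 <= e <= p] there is exactly one relation of the form
    [x_1 ... = x_e ...], and there is no other relation.

    The graph joining the first letters of the relations is thus a tree, a star
    with center [x_1], and by an argument going back to Adjan this implies left
    cancellation ([star_left_cancellative]): a rewriting chain that changes the
    first letter leaves and reenters [x_1] by the same relation, so that it can
    be shortened. The same analysis shows that the relation for [e] is the right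
    lcm of [x_1] and [x_e] ([star_right_lcm]), and that a common multiple of two
    distinct generators is a multiple of [x_1] ([star_common_multiple]).

    Hence, for distinct [i, j > 1], the lcm of [x_i] and [x_j] is that of the
    relations [L i] and [L j]. Now [L e] is [c^alpha] (if [p] divides [q]),
    [c^(alpha+1)] (if [e <= beta]) or [c^alpha x_{e-beta}] (if [e > beta]), so
    factoring out [c^alpha] computes all these lcms by recursion on the indices
    ([torus_lcm_lt]). As the relations preserve length, lcms of generators
    provide an lcm for any two elements that have a common multiple
    ([right_lcm_from_atoms]).

    Common multiples come from [Delta]. The relations imply
    [c^((i+q) %/ p) x_{i+1} = x_{(i+q) %% p + 1} c^((i+q) %/ p)] for [0 <= i < p]
    ([torus_step]): conjugation by powers of [c] rotates the generators by [q]
    modulo [p]. After [p / gcd(p, q)] steps the rotation is trivial and the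
    accumulated exponent is [q / gcd(p, q)], so that [Delta] is central. In a
    cancellative monoid, [Delta = a b] is then also [b a]; this identifies its
    left and right divisors, and shows that all generators, which occur in
    [Delta], divide it.

    Finally, reversing words and exchanging [x_i] with [x_{p+1-i}] is an
    anti-automorphism ([torus_flip]), which yields right cancellation and left
    lcms. *)

(** * Divisibility and lcms in monoids *)

Section MonoidLcm.
Variable M : monoidType.
Implicit Types a b c d m : M.

Lemma left_divisor_refl a : left_divisor a a.
Proof. by exists 1; rewrite mulg1. Qed.

Lemma left_divisor_mulr a b : left_divisor a (a * b).
Proof. by exists b. Qed.

Lemma left_divisor_trans b a c :
  left_divisor a b -> left_divisor b c -> left_divisor a c.
Proof. by move=> [d ->] [e ->]; exists (d * e); rewrite mulgA. Qed.

Lemma left_divisor_mul2l d a b :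
  left_divisor a b -> left_divisor (d * a) (d * b).
Proof. by move=> [e ->]; exists e; rewrite mulgA. Qed.

Lemma left_divisor_mul2lK d a b : left_cancellative M ->
  left_divisor (d * a) (d * b) -> left_divisor a b.
Proof. by move=> canM [e]; rewrite -mulgA => /canM->; exists e. Qed.

Lemma is_right_lcmC c a b : is_right_lcm c a b -> is_right_lcm c b a.
Proof. by move=> [ca cb lub]; split=> // m mb ma; apply: lub. Qed.

Lemma right_lcm_divisor a b : left_divisor a b -> is_right_lcm b a b.
Proof. by move=> ab; split=> //; apply: left_divisor_refl. Qed.

Lemma right_lcm_mul2l d c a b : left_cancellative M ->
  is_right_lcm c a b -> is_right_lcm (d * c) (d * a) (d * b).
Proof.
move=> canM [ca cb lub]; split; try exact: left_divisor_mul2l.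
move=> _ [m ->]; rewrite -mulgA => /(left_divisor_mul2lK canM) bm.
by apply/left_divisor_mul2l/lub => //; apply: left_divisor_mulr.
Qed.

Lemma is_right_lcm_eqv c a b a' b' :
    (forall m, left_divisor a m /\ left_divisor b m <->
               left_divisor a' m /\ left_divisor b' m) ->
  is_right_lcm c a b -> is_right_lcm c a' b'.
Proof.
move=> eqm [ca cb lub]; have [? ?] := (eqm c).1 (conj ca cb).
split=> // m ma mb; have [ma' mb'] := (eqm m).2 (conj ma mb).
exact: lub.
Qed.

(** In a left cancellative monoid with an additive length, lcms of atoms give
    all lcms, by induction on the length of a common multiple: for [a = s a']
    and [b = t b'], the lcm of [a] and [b] is that of [a \/ (s \/ t)] and
    [(s \/ t) \/ b], and each of the three joins in this expression only
    involves, once an atom is cancelled, a shorter common multiple. *)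
Lemma right_lcm_from_atoms (len : M -> nat) (A : M -> Prop) :
    {morph len : a b / a * b >-> (a + b)%N} ->
    (forall a, a = 1 \/ exists s a', [/\ A s, (0 < len s)%N & a = s * a']) ->
    left_cancellative M ->
    (forall s t, A s -> A t -> exists c, is_right_lcm c s t) ->
  forall m a b, left_divisor a m -> left_divisor b m ->
    exists c, is_right_lcm c a b.
Proof.
move=> lenM splitA canM lcmA m.
have [n] := ubnP (len m); elim: n m => // n IHn m ltmn a b am bm.
have [a1|[s [a' [As len_s def_a]]]] := splitA a.
  by exists b; apply: right_lcm_divisor; exists b; rewrite a1 mul1g.
have [b1|[t [b' [At len_t def_b]]]] := splitA b.
  exists a; apply/is_right_lcmC/right_lcm_divisor.
  by exists a; rewrite b1 mul1g.
have sm : left_divisor s m.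
  by apply: left_divisor_trans am; exists a'.
have tm : left_divisor t m.
  by apply: left_divisor_trans bm; exists b'.
have [c [[s' def_c] [t' def_c'] c_lub]] := lcmA s t As At.
have cm : left_divisor c m by apply: c_lub.
have step r x y : (0 < len r)%N -> left_divisor (r * x) m ->
    left_divisor (r * y) m -> exists z, is_right_lcm (r * z) (r * x) (r * y).
  move=> len_r [x' def_m]; rewrite def_m -mulgA => /(left_divisor_mul2lK canM) ym.
  have lt_n : (len (x * x')%g < n)%N.
    move: ltmn; rewrite def_m -mulgA (lenM r) ltnS; apply: leq_trans.
    by rewrite -add1n leq_add2r.
  have [z lcm_z] := IHn _ lt_n x y (left_divisor_mulr _ _) ym.
  by exists z; apply: right_lcm_mul2l.
have [|||d1 lcm1] := step s a' s'; rewrite -?def_a -?def_c //.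
have [|||d2 lcm2] := step t b' t'; rewrite -?def_b -?def_c' //.
have am1 : left_divisor (s * d1) m.
  by case: lcm1 => _ _; apply; rewrite -?def_a -?def_c.
have bm1 : left_divisor (t * d2) m.
  by case: lcm2 => _ _; apply; rewrite -?def_b -?def_c'.
have [e def_e] : left_divisor s (t * d2).
  apply: (@left_divisor_trans c); first by exists s'.
  by case: lcm2 => _; rewrite -def_c'.
have [||| z lcm_z] := step s d1 e; rewrite -?def_e //.
exists (s * z); apply: is_right_lcm_eqv lcm_z => k; rewrite -def_e.
case: lcm1 lcm2; rewrite -def_a -def_c => ad1 cd1 lub1.
rewrite -def_b -def_c' => -[bd2 cd2 lub2].
split=> -[k1 k2]; split; try by apply: left_divisor_trans k1.
- by apply: left_divisor_trans k2.
- apply: lub1 => //; apply: c_lub; [apply: left_divisor_trans k1|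
    apply: left_divisor_trans k2]; [by exists a' | by exists b'].
- apply: lub2 => //; apply: c_lub; [apply: left_divisor_trans k1|
    apply: left_divisor_trans k2]; [by exists a' | by exists b'].
Qed.

(** When [ab] is central, [a (ba) = (ab) a = a (ab)]; then cancel [a]. *)
Lemma central_mulC c a b : left_cancellative M ->
  (forall x, commute c x) -> c = a * b -> c = b * a.
Proof.
by move=> canM cen def_c; apply: (canM a); rewrite mulgA -def_c; exact/esym/cen.
Qed.

Lemma central_divisorC c a : left_cancellative M ->
  (forall x, commute c x) -> left_divisor a c <-> right_divisor a c.
Proof. by move=> canM cen; split=> -[b def_c]; exists b; apply: central_mulC. Qed.

(** An involutive anti-automorphism transports each statement about left
    divisibility to its mirror image. *)
Section Flip.
Variable rho : M -> M.
Hypothesis rhoM : forall a b, rho (a * b) = rho b * rho a.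
Hypothesis rhoK : involutive rho.

Lemma flip_left_divisor a b : left_divisor (rho a) (rho b) <-> right_divisor a b.
Proof.
split=> -[d]; last by move=> ->; exists (rho d).
by move/(congr1 rho); rewrite rhoM !rhoK => ->; exists (rho d).
Qed.

Lemma flip_right_cancellative : left_cancellative M -> right_cancellative M.
Proof.
by move=> canM a b c /(congr1 rho); rewrite !rhoM => /canM/(inv_inj rhoK).
Qed.

Lemma flip_left_lcm c a b :
  is_right_lcm (rho c) (rho a) (rho b) -> is_left_lcm c a b.
Proof.
move=> [ca cb lub]; split; do ?exact/flip_left_divisor.
by move=> m /flip_left_divisor am /flip_left_divisor bm;
   apply/flip_left_divisor/lub.
Qed.

End Flip.

End MonoidLcm.

(** * Presented monoids *)

Section PresentedMonoid.
Variables (X : choiceType) (R : seq X -> seq X -> Prop).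
Implicit Types (s t : X) (u v w : seq X).

Local Notation M := (presented_monoid R).
Local Notation cls := (pres_class R).
Local Notation "u ~ v" := (pres_cong R u v) (at level 70).

Lemma pres_classM u v : cls (u ++ v) = cls u * cls v.
Proof. by rewrite -pres_class_cat. Qed.

Lemma pres_class_cons s u : cls (s :: u) = cls [:: s] * cls u.
Proof. by rewrite -pres_classM. Qed.

Lemma pres_class_nil : cls [::] = 1.
Proof. by []. Qed.

Lemma pres_class_prod u : cls u = \prod_(s <- u) cls [:: s].
Proof.
elim: u => [|s u IHu]; first by rewrite big_nil.
by rewrite big_cons -IHu pres_class_cons.
Qed.

Lemma pres_classP (a : M) : exists u, a = cls u.
Proof. by exists (pres_repr a); rewrite pres_reprK. Qed.

(** Induction along a chain of elementary rewritings. Quantifying over all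
    predicates in the induction makes the compatibility of the congruence with
    concatenation provable: if [P] is stable then so is [P (_ ++ v)]. *)
Lemma pres_cong_stable (P : seq X -> Prop) :
    (forall u v w w', R w w' -> P (u ++ w ++ v) <-> P (u ++ w' ++ v)) ->
  forall u v, u ~ v -> (P u <-> P v).
Proof.
move=> stabP u v uv; elim: uv P stabP => {u v}.
- by move=> u v Ruv P stabP; have := stabP [::] [::] u v Ruv; rewrite !cats0.
- by [].
- by move=> u v _ IH P stabP; apply: iff_sym; apply: IH.
- by move=> v u w _ IH1 _ IH2 P stabP; apply: iff_trans (IH1 P _) (IH2 P _).
- move=> u u' v v' _ IHu _ IHv P stabP.
  apply: (iff_trans (IHu (fun w => P (w ++ v)) _) (IHv (fun w => P (u' ++ w)) _)).
    by move=> x y w w' Rw; have := stabP x (y ++ v) w w' Rw; rewrite -!catA.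
  by move=> x y w w' Rw; have := stabP (u' ++ x) y w w' Rw; rewrite -!catA.
Qed.

(** Reading words backwards while relabelling the letters defines an
    anti-automorphism as soon as the relations are mapped to consequences of
    the relations. *)
Lemma pres_flip (f : X -> X) : involutive f ->
    (forall u v, R u v -> rev (map f u) ~ rev (map f v)) ->
  exists rho : M -> M, (forall a b, rho (a * b) = rho b * rho a) /\ involutive rho.
Proof.
move=> fK Rf; pose g u := rev (map f u).
have gcat u v : g (u ++ v) = g v ++ g u by rewrite /g map_cat rev_cat.
have gK : involutive g.
  by move=> u; rewrite /g map_rev revK -map_comp (eq_map fK) map_id.
have g_cong u v : u ~ v -> g u ~ g v.
  elim=> {u v}.
  - exact: Rf.
  - by move=> u; apply: pres_cong_refl.
  - by move=> u v _; apply: pres_cong_sym.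
  - by move=> v u w _ IH1 _ IH2; apply: pres_cong_trans IH2.
  - by move=> u u' v v' _ IHu _ IHv; rewrite !gcat; apply: pres_cong_cat.
pose rho (a : M) : M := cls (g (pres_repr a)).
have rho_class u : rho (cls u) = cls (g u).
  by apply/pres_class_eq/g_cong/pres_class_eq; rewrite pres_reprK.
exists rho; split=> [a b|a]; have [u ->] := pres_classP a.
  have [v ->] := pres_classP b.
  by rewrite -pres_classM !rho_class -pres_classM gcat.
by rewrite !rho_class gK.
Qed.

Hypothesis R_size : forall u v, R u v -> size u = size v.

Lemma pres_cong_size u v : u ~ v -> size u = size v.
Proof.
move=> uv; apply/esym/((pres_cong_stable (P := fun w => size w = size u) _ uv).1) => //.
by move=> x y w w' /R_size eq_w; rewrite !size_cat eq_w.
Qed.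

Definition pres_length (a : M) := size (pres_repr a).

Lemma pres_length_class u : pres_length (cls u) = size u.
Proof. by apply/pres_cong_size/pres_class_eq; rewrite pres_reprK. Qed.

Lemma pres_lengthM : {morph pres_length : a b / a * b >-> (a + b)%N}.
Proof.
move=> a b; have [u ->] := pres_classP a; have [v ->] := pres_classP b.
by rewrite -pres_classM !pres_length_class size_cat.
Qed.

Lemma pres_length_eq0 a : pres_length a = 0 -> a = 1.
Proof.
by have [u ->] := pres_classP a; rewrite pres_length_class => /size0nil->.
Qed.

Lemma pres_conical : conical M.
Proof.
move=> a [b [ab1 _]]; apply: pres_length_eq0.
have := congr1 pres_length ab1; rewrite pres_lengthM.
by rewrite -pres_class_nil pres_length_class /=; lia.
Qed.

Lemma pres_head_split (a : M) :
  a = 1 \/ exists b a', [/\ exists s, b = cls [:: s], (0 < pres_length b)%N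
                          & a = b * a'].
Proof.
have [[|t u] ->] := pres_classP a; [by left | right].
exists (cls [:: t]), (cls u); rewrite pres_length_class (pres_class_cons t u).
by split=> //; exists t.
Qed.

End PresentedMonoid.

(** * Presentations with a star-shaped left graph *)

(** The left graph of a presentation has the generators as vertices and joins
    the first letters of the two sides of each relation. Here it is a star with
    center [o], without multiple edges; cancellation is proved by induction on
    the length of words, whence [star_size]. *)
Record star_presentation (X : choiceType) (o : X) (R : seq X -> seq X -> Prop) :=
  StarPresentation {
    star_shape : forall w w', R w w' ->
      exists s u v, [/\ s != o, w = o :: u & w' = s :: v];
    star_size : forall w w', R w w' -> size w = size w';
    star_uniq : forall s u v u' v',
      R (o :: u) (s :: v) -> R (o :: u') (s :: v') -> u = u' /\ v = v'
  }.

Section StarPresentation.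
Variables (X : choiceType) (o : X) (R : seq X -> seq X -> Prop).
Hypothesis starR : star_presentation o R.
Implicit Types (s t : X) (u v w z : seq X).

Local Notation M := (presented_monoid R).
Local Notation cls := (pres_class R).
Local Notation "u ~ v" := (pres_cong R u v) (at level 70).

#[local] Hint Resolve pres_cong_refl : core.

Lemma cong_cons s u v : u ~ v -> s :: u ~ s :: v.
Proof. by move=> uv; rewrite -[s :: u]cat1s -[s :: v]cat1s; apply: pres_cong_cat. Qed.

(** A canonical shape for the rewritings from [s u] to [o z], in which a relation
    is applied at most once at the head of the word. *)
Definition via_center s u z :=
  (s = o /\ u ~ z) \/
  exists a b d, [/\ R (o :: a) (s :: b), u ~ b ++ d & z ~ a ++ d].

Lemma star_neq s a b : R (o :: a) (s :: b) -> s != o.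
Proof. by case/(star_shape starR) => t [u [v [nt _ [-> _]]]]. Qed.

Lemma via_center_o u z : via_center o u z -> u ~ z.
Proof. by case=> [[]//|[a [b [d [/star_neq]]]]]; rewrite eqxx. Qed.

Lemma via_center_congl s u v z : u ~ v -> via_center s u z -> via_center s v z.
Proof.
move=> /pres_cong_sym vu [[-> uz]|[a [b [d [Rab ub zd]]]]].
  by left; split=> //; apply: pres_cong_trans uz.
by right; exists a, b, d; split=> //; apply: pres_cong_trans ub.
Qed.

Lemma via_center_congr s u v z : u ~ v -> via_center s z u -> via_center s z v.
Proof.
move=> uv [[-> zu]|[a [b [d [Rab ub zd]]]]].
  by left; split=> //; apply: pres_cong_trans uv.
right; exists a, b, d; split=> //.
by apply: pres_cong_trans zd; apply: pres_cong_sym.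
Qed.

Lemma star_size_tail s a b : R (o :: a) (s :: b) -> size a = size b.
Proof. by case/(star_size starR). Qed.

Lemma cat_cancel n w u v :
    (forall s u v, (size u < n)%N -> s :: u ~ s :: v -> u ~ v) ->
  (size (w ++ u) <= n)%N -> w ++ u ~ w ++ v -> u ~ v.
Proof.
move=> canR; elim: w => //= s w IHw lt_n /canR H.
by apply: IHw; [exact: ltnW | exact: H].
Qed.

(** The conclusion is invariant under rewriting. The only delicate step is a
    chain that leaves the center by a relation and comes back to it: by
    uniqueness it comes back by the same relation, and cancellation for shorter
    words shows that it comes back to the same [z]. *)
Lemma star_chain n s u t v :
    (forall s u v, (size u < n)%N -> s :: u ~ s :: v -> u ~ v) ->
    (size u <= n)%N -> s :: u ~ t :: v ->
  (t = s /\ u ~ v) \/ exists2 z, via_center s u z & via_center t v z.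
Proof.
move=> canR le_un suv.
pose P w := s :: u ~ w /\ forall t v, w = t :: v ->
  (t = s /\ u ~ v) \/ exists2 z, via_center s u z & via_center t v z.
suff: P (t :: v) by case=> _; apply.
apply: (pres_cong_stable _ suv).1; last first.
  by split=> [|_ _ [<- <-]]; [| left].
move=> {t v suv} [|r x] y w w' Rw; last first.
  (* the rewriting takes place inside the tail *)
  have tail : x ++ w ++ y ~ x ++ w' ++ y.
    by do !apply: pres_cong_cat => //; apply: pres_cong_rel.
  have [hd hd'] := (cong_cons r tail, pres_cong_sym (cong_cons r tail)).
  split=> -[chain inv]; split; do ?exact: pres_cong_trans chain _.
  - move=> _ _ [<- <-]; have [[-> ux]|[z sz rz]] := inv _ _ erefl.
      by left; split=> //; apply: pres_cong_trans tail.
    by right; exists z => //; apply: via_center_congl rz.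
  - move=> _ _ [<- <-]; have [[-> ux]|[z sz rz]] := inv _ _ erefl.
      left; split=> //; apply: pres_cong_trans ux _; exact: pres_cong_sym.
    by right; exists z => //; apply: via_center_congl rz; apply: pres_cong_sym.
(* the rewriting takes place at the head *)
have [e [a [b [neo def_w def_w']]]] := star_shape starR Rw.
move: Rw; rewrite def_w def_w' /= => Rab.
have swap : via_center e (b ++ y) (a ++ y).
  by right; exists a, b, y.
have hd : o :: a ++ y ~ e :: b ++ y.
  by rewrite -!cat_cons; apply: pres_cong_cat => //; apply: pres_cong_rel.
split=> -[chain inv]; split; do ?by apply: pres_cong_trans chain _ => //;
  apply: pres_cong_sym.
- move=> _ _ [<- <-]; right; have [[os ua]|[z sz oz]] := inv _ _ erefl.
    by exists (a ++ y) => //; left; rewrite os.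
  exists (a ++ y) => //; apply: via_center_congr sz.
  exact/pres_cong_sym/via_center_o.
- move=> _ _ [<- <-]; right; exists (a ++ y); last by left.
  have [[es ub]|[z sz ez]] := inv _ _ erefl.
    by rewrite -es; apply: via_center_congl swap; apply: pres_cong_sym.
  case: ez => [[eo]|[a' [b' [d [Rab' byd zad]]]]]; first by rewrite eo eqxx in neo.
  have [eq_a eq_b] := star_uniq starR Rab Rab'; subst a' b'.
  apply: via_center_congr sz; apply: pres_cong_trans zad _.
  apply: pres_cong_cat => //.
  apply/pres_cong_sym/(cat_cancel canR _ byd); apply: leq_trans le_un.
  have := pres_cong_size (star_size starR) chain.
  by rewrite /= => -[->].
Qed.

Lemma star_cancel s u v : s :: u ~ s :: v -> u ~ v.
Proof.
have [n] := ubnP (size u); elim: n s u v => // n IHn s u v; rewrite ltnS => le_un.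
move=> suv; have [[]//|[z uz vz]] := star_chain IHn le_un suv.
case: uz => [[eso uz]|[a [b [d [Rab ubd zad]]]]].
  rewrite eso in vz; apply: pres_cong_trans uz _.
  exact/pres_cong_sym/via_center_o.
case: vz => [[eso _]|[a' [b' [d' [Rab' vbd zad']]]]].
  by have := star_neq Rab; rewrite eso eqxx.
have [eq_a eq_b] := star_uniq starR Rab Rab'; subst a' b'.
have sz_u := pres_cong_size (star_size starR) ubd.
apply: pres_cong_trans ubd _; apply: pres_cong_trans (pres_cong_sym vbd).
apply: pres_cong_cat => //.
apply: (cat_cancel IHn) (pres_cong_trans (pres_cong_sym zad) zad').
by rewrite !size_cat (star_size_tail Rab) -size_cat -sz_u.
Qed.

Lemma star_left_cancellative : left_cancellative M.
Proof.
move=> a b c; have [u ->] := pres_classP a.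
have [v ->] := pres_classP b; have [w ->] := pres_classP c.
elim: u => [|s u IHu]; first by rewrite !mul1g.
rewrite -!pres_classM !cat_cons => /pres_class_eq/star_cancel suv.
by apply: IHu; rewrite -!pres_classM; apply/pres_class_eq.
Qed.

Lemma star_link s t u v : s != t -> s :: u ~ t :: v ->
  exists2 z, via_center s u z & via_center t v z.
Proof.
move=> nst; case/(star_chain (fun s u v _ => @star_cancel s u v) (leqnn (size u))) => //.
by case=> est; rewrite est eqxx in nst.
Qed.

(** Two distinct generators have no common multiple outside those of the
    center, as every path between them in the star visits it. *)
Lemma star_common_multiple s t (m : M) : s != t ->
    left_divisor (cls [:: s]) m -> left_divisor (cls [:: t]) m ->
  left_divisor (cls [:: o]) m.
Proof.
move=> nst [a ->] [b]; have [u ->] := pres_classP a; have [v ->] := pres_classP b.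
rewrite -!pres_class_cons => /pres_class_eq/(star_link nst)[z sz _].
exists (cls z); rewrite -pres_class_cons; apply/pres_class_eq.
case: sz => [[-> uz]|[a' [b' [d [Rab ubd zad]]]]]; first exact: cong_cons.
apply: pres_cong_trans (cong_cons s ubd) _.
apply: pres_cong_trans (pres_cong_sym (cong_cons o zad)).
rewrite -!cat_cons; apply: pres_cong_cat => //.
exact/pres_cong_sym/pres_cong_rel.
Qed.

Lemma star_right_lcm s u v : R (o :: u) (s :: v) ->
  is_right_lcm (cls (o :: u)) (cls [:: o]) (cls [:: s]).
Proof.
move=> Ruv; split.
- by exists (cls u); rewrite -pres_class_cons.
- exists (cls v); rewrite -pres_class_cons; apply/pres_class_eq; exact: pres_cong_rel.
move=> _ [a ->] [b]; have [x ->] := pres_classP a; have [y ->] := pres_classP b.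
have nos : o != s by rewrite eq_sym (star_neq Ruv).
rewrite -!pres_class_cons => /pres_class_eq/(star_link nos)[z /via_center_o xz].
case=> [[eso _]|[a' [b' [d [Rab ybd zad]]]]]; first by rewrite eso eqxx in nos.
have [eq_a eq_b] := star_uniq starR Ruv Rab; subst a' b'.
exists (cls d); rewrite -pres_classM cat_cons; apply/pres_class_eq/cong_cons.
exact: pres_cong_trans zad.
Qed.

End StarPresentation.

(** * Words of consecutive letters *)

Section ConsecutiveWords.
Variable p : nat.
Implicit Types (u w : seq 'I_p) (i : 'I_p).

Local Notation W := (xword p).

Lemma xword_cat a b d : (0 < a <= b.+1)%N -> (b <= d <= p)%N ->
  W a b ++ W b.+1 d = W a d.
Proof.
move=> /andP[a0 ab] /andP[bd dp].
apply: (@inj_map _ _ (fun i : 'I_p => (val i).+1)); first by move=> i j [/val_inj].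
rewrite map_cat !xwordE //; last exact: leq_trans dp.
have -> : (d.+1 - a = (b.+1 - a) + (d.+1 - b.+1))%N by lia.
by rewrite iotaD; congr (_ ++ iota _ _); lia.
Qed.

Lemma xword_nil a b : (b < a)%N -> W a b = [::].
Proof.
move=> ba; apply/eqP; rewrite -size_eq0 size_filter -leqn0 -ltnS ltnS leqn0.
by rewrite -[_ == 0]negbK -lt0n -has_count; apply/hasPn => i _ /=; lia.
Qed.

Lemma size_xword a b : (0 < a)%N -> (b <= p)%N -> size (W a b) = (b.+1 - a)%N.
Proof. by move=> a0 bp; rewrite -[RHS](size_iota a) -(@xwordE p) // size_map. Qed.

Lemma xword_letter i : W i.+1 i.+1 = [:: i].
Proof.
apply: (@inj_map _ _ (fun i : 'I_p => (val i).+1)); first by move=> j k [/val_inj].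
by rewrite xwordE // subSnn.
Qed.

Lemma letter_of_index e : (1 <= e <= p)%N -> exists i, e = i.+1.
Proof.
by case: e => // e ep; exists (Ordinal ep).
Qed.

Lemma xword_cons i b : (i < b <= p)%N -> W i.+1 b = i :: W i.+2 b.
Proof.
by move=> ibp; rewrite -cat1s -xword_letter xword_cat //; lia.
Qed.

Lemma xword_all : W 1 p = enum 'I_p.
Proof. by apply/all_filterP/allP => i _ /=; apply: ltn_ord. Qed.

Lemma xword_flip a b : (0 < a)%N ->
  rev (map (@rev_ord p) (W a b)) = W (p.+1 - b) (p.+1 - a).
Proof.
move=> a0.
have enum_flip : rev (map (@rev_ord p) (enum 'I_p)) = enum 'I_p.
  apply: (inj_map val_inj); rewrite map_rev -map_comp val_enum_ord.
  have sz_e : size [seq val (rev_ord i) | i : 'I_p <- enum 'I_p] = p.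
    by rewrite size_map size_enum_ord.
  apply: (@eq_from_nth _ 0); rewrite size_rev sz_e ?size_iota // => i ip.
  rewrite nth_rev sz_e // nth_iota //.
  have ip' : (p - i.+1 < p)%N by lia.
  rewrite (nth_map (Ordinal ip)) ?size_enum_ord //= nth_enum_ord //.
  by rewrite add0n; lia.
rewrite /xword -{2}enum_flip filter_rev filter_map; congr (rev (map _ _)).
by apply: eq_filter => i /=; have := ltn_ord i; lia.
Qed.

Lemma word_expS w n : word_exp w n.+1 = w ++ word_exp w n.
Proof. by []. Qed.

Lemma word_expSr w n : word_exp w n.+1 = word_exp w n ++ w.
Proof.
elim: n => [|n IHn]; first by rewrite /word_exp /= cats0.
by rewrite word_expS {1}IHn catA -word_expS.
Qed.

Lemma word_exp_flip w n :
  rev (map (@rev_ord p) (word_exp w n)) =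
  word_exp (rev (map (@rev_ord p) w)) n.
Proof.
elim: n => // n IHn; rewrite word_expSr map_cat rev_cat IHn.
by rewrite word_expS.
Qed.

Lemma size_word_exp w n : size (word_exp w n) = (n * size w)%N.
Proof. by elim: n => // n IHn; rewrite word_expSr size_cat IHn mulSn addnC. Qed.

Lemma pres_class_word_exp (R : seq 'I_p -> seq 'I_p -> Prop) w n :
  pres_class R (word_exp w n) = pres_class R w ^+ n.
Proof.
by elim: n => // n IHn; rewrite word_expSr pres_classM IHn expgSr.
Qed.

End ConsecutiveWords.

(** * The torus link Artin monoid *)

Section Torus.
Variables p q : nat.
Hypotheses (hp : (2 <= p)%N) (hpq : (p <= q)%N).
Implicit Types (w : seq 'I_p).

Local Notation M := (torus_monoid p q).
Local Notation R := (@torus_rel p q).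
Local Notation W := (xword p).
Local Notation alpha := (q %/ p)%N.
Local Notation beta := (q %% p)%N.

Let p_gt0 : (0 < p)%N. Proof. exact: ltnW. Qed.
Let alpha_gt0 : (0 < alpha)%N. Proof. by rewrite divn_gt0. Qed.
Let beta_ltp : (beta < p)%N. Proof. by rewrite ltn_mod. Qed.

(** The three families of relations, indexed by the second generator [x_e] that
    they involve: each [2 <= e <= p] occurs in exactly one relation
    [x_1 ... = x_e ...], which is the star shape of the left graph. *)
Definition torus_lhs e : seq 'I_p :=
  word_exp (W 1 p) alpha ++
  (if beta == 0 then [::] else if (e <= beta)%N then W 1 p
   else W (e - beta) (e - beta)).

Definition torus_rhs e : seq 'I_p :=
  if beta == 0 then word_exp (W e p ++ W 1 e.-1) alpha
  else if (e <= beta)%N then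
    W e p ++ word_exp (W 1 p) alpha ++ W (p - beta + 1) (p - beta + e - 1)
  else W e e ++ word_exp (W 1 p) alpha.

Lemma torus_relP w w' : R w w' <->
  exists2 e, (2 <= e <= p)%N & w = torus_lhs e /\ w' = torus_rhs e.
Proof.
rewrite /torus_lhs /torus_rhs; split=> [[e b0 ep|e b0 eb|j b0 jb]|[e ep]].
- by exists e => //; rewrite -/(dvdn p q) b0 cats0.
- exists e; first by have := beta_ltp; lia.
  by rewrite -/(dvdn p q) (negPf b0) (andP eb).2 -word_expSr.
- exists (beta + j)%N; first by move: b0; rewrite /dvdn; lia.
  rewrite -/(dvdn p q) (negPf b0) addKn.
  by case: leqP => //; move: jb; lia.
case: eqP => [b0|/eqP b0]; first by
  rewrite cats0 => -[-> ->]; apply: torus_rel_dvd => //; apply/eqP.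
case: leqP => [eb|be] [-> ->].
  by rewrite -word_expSr; apply: torus_rel_power; rewrite ?(andP ep).1.
have {3 4}-> : e = (beta + (e - beta))%N by lia.
by apply: torus_rel_shift => //; lia.
Qed.

Let x1 : 'I_p := Ordinal p_gt0.

Lemma torus_lhs_head e : exists u, torus_lhs e = x1 :: u.
Proof.
rewrite /torus_lhs -(prednK alpha_gt0) word_expS (@xword_cons p x1) /=; last by lia.
by eexists.
Qed.

Lemma torus_rhs_head (i : 'I_p) : (0 < i)%N -> exists u, torus_rhs i.+1 = i :: u.
Proof.
move=> i0; have ip := ltn_ord i.
rewrite /torus_rhs -(prednK alpha_gt0) !word_expS (@xword_cons p i p) ?ip //=.
rewrite xword_letter.
by do !case: ifP => _; eexists.
Qed.

Lemma torus_size e : (2 <= e <= p)%N -> size (torus_lhs e) = size (torus_rhs e).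
Proof.
move=> ep; have bp := beta_ltp; rewrite /torus_lhs /torus_rhs.
case: eqP => b0; last case: leqP => eb;
  by rewrite ?(size_cat, size_word_exp) ?size_xword /=; lia.
Qed.

Lemma torus_star : star_presentation x1 R.
Proof.
split=> [w w' | w w' | i u v u' v'].
- move=> /torus_relP[e ep [-> ->]].
  have [|k def_e] := @letter_of_index p e; first by lia.
  have [u ->] := torus_lhs_head e; rewrite {e}def_e in ep *.
  have [|v ->] := @torus_rhs_head k; first by lia.
  by exists k, u, v; split=> //; rewrite -val_eqE /=; lia.
- by move=> /torus_relP[e ep [-> ->]]; apply: torus_size.
have idx e w : (2 <= e <= p)%N -> i :: w = torus_rhs e -> e = i.+1.
  move=> ep; have [|k def_e] := @letter_of_index p e; first by lia.
  rewrite {e}def_e in ep *; have [|? ->] := @torus_rhs_head k; first by lia.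
  by move=> [->].
move=> /torus_relP[e ep [lhs_e rhs_e]] /torus_relP[e' ep' [lhs_e' rhs_e']].
have eq_e : e = e' by rewrite (idx _ _ ep rhs_e) (idx _ _ ep' rhs_e').
by move: lhs_e' rhs_e'; rewrite -eq_e -lhs_e -rhs_e => -[->] [->].
Qed.

Lemma torus_left_cancellative : left_cancellative M.
Proof. exact: star_left_cancellative torus_star. Qed.

Local Notation X a b := (pres_class R (W a b) : M).
Local Notation c := (X 1 p).

Lemma X_cat a b d : (0 < a <= b.+1)%N -> (b <= d <= p)%N ->
  X a b * X b.+1 d = X a d.
Proof. by move=> ab bd; rewrite -pres_classM xword_cat. Qed.

Lemma X_nil a b : (b < a)%N -> X a b = 1.
Proof. by move=> ba; rewrite xword_nil. Qed.

Lemma torus_dvd e : beta = 0 -> (1 <= e <= p.+1)%N ->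
  (X e p * X 1 e.-1) ^+ alpha = c ^+ alpha.
Proof.
move=> b0 ep; have [->|e1] := eqVneq e 1%N; first by rewrite [X 1 0]X_nil // mulg1.
have [->|ep1] := eqVneq e p.+1; first by rewrite [X _ p]X_nil // mul1g.
have /torus_relP/pres_cong_rel/pres_class_eq/esym :
    exists2 k, (2 <= k <= p)%N & torus_lhs e = torus_lhs k /\ torus_rhs e = torus_rhs k.
  by exists e => //; lia.
by rewrite /torus_lhs /torus_rhs b0 eqxx cats0 !pres_class_word_exp pres_classM.
Qed.

Lemma torus_shift j : (1 <= j <= p - beta)%N ->
  c ^+ alpha * X j j = X (beta + j) (beta + j) * c ^+ alpha.
Proof.
move=> jb; have [b0|b0] := eqVneq beta 0.
  (* The rotations of [c] starting at [x_j] and [x_{j+1}] are [x_j y] and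
     [y x_j]; their powers [alpha] agree, and [(x_j y)^n x_j = x_j (y x_j)^n]. *)
  rewrite b0 subn0 add0n in jb *.
  pose y := X j.+1 p * X 1 j.-1.
  have yl : X j p * X 1 j.-1 = X j j * y.
    by rewrite /y mulgA X_cat //; lia.
  have yr : X j.+1 p * X 1 j.+1.-1 = y * X j j.
    rewrite /y -mulgA; congr (_ * _).
    by rewrite -{3}(@prednK j) ?X_cat //; lia.
  rewrite -{1}(@torus_dvd j) ?yl //; last by lia.
  rewrite -(@torus_dvd j.+1) ?yr //; last by lia.
  elim: alpha => [|n IHn]; first by rewrite mul1g mulg1.
  by rewrite expgS -mulgA IHn expgS !mulgA.
have : R (torus_lhs (beta + j)) (torus_rhs (beta + j)).
  by apply/torus_relP; exists (beta + j)%N => //; have := beta_ltp; lia.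
move/pres_cong_rel/pres_class_eq; rewrite /torus_lhs /torus_rhs (negPf b0) addKn.
by case: leqP => [|_]; [lia | rewrite !pres_classM !pres_class_word_exp].
Qed.

Lemma torus_shift_range m : (m <= p - beta)%N ->
  c ^+ alpha * X 1 m = X beta.+1 (beta + m) * c ^+ alpha.
Proof.
elim: m => [|m IHm] mb; first by
  rewrite [X 1 0]X_nil // [X _ (_ + 0)]X_nil ?addn0 // mulg1 mul1g.
rewrite -(@X_cat 1 m m.+1) ?leqnSn; try by have := beta_ltp; lia.
rewrite mulgA IHm -?mulgA; last exact: ltnW.
rewrite torus_shift ?mb // mulgA !addnS -(@X_cat beta.+1 (beta + m) (beta + m).+1) //.
  by lia.
by have := beta_ltp; lia.
Qed.

(** The boundary case [e = beta + 1], to be compared with [e = beta] in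
    [torus_wrap], amounts to moving [c^alpha] across [x_1 ... x_{p-beta}]. *)
Lemma torus_power e : beta != 0 -> (1 <= e <= beta.+1)%N ->
  X e p * c ^+ alpha * X (p - beta + 1) (p - beta + e - 1) = c ^+ alpha.+1.
Proof.
move=> b0 eb; have bp := beta_ltp; have [->|e1] := eqVneq e 1%N.
  by rewrite [X (_ + 1) _]X_nil ?mulg1 ?expgS //; lia.
have [->|eb1] := eqVneq e beta.+1.
  have -> : X beta.+1 p = X beta.+1 (beta + (p - beta)) by congr (X _ _); lia.
  rewrite -torus_shift_range // -mulgA expgSr; congr (_ * _).
  by rewrite addn1 X_cat //; [congr (X _ _) |]; lia.
have : R (torus_lhs e) (torus_rhs e).
  by apply/torus_relP; exists e => //; lia.
move/pres_cong_rel/pres_class_eq; rewrite /torus_lhs /torus_rhs (negPf b0).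
case: leqP => [_|]; last by lia.
by rewrite !pres_classM !pres_class_word_exp mulgA expgSr => ->.
Qed.

(** With [w = x_{e+1} ... x_p c^alpha x_{p-beta+1} ... x_{p-beta+e-1}], two
    consecutive relations read [x_e w = c^(alpha+1) = w x_{p-beta+e}]. *)
Lemma torus_wrap e : (1 <= e <= beta)%N ->
  c ^+ alpha.+1 * X (p - beta + e) (p - beta + e) = X e e * c ^+ alpha.+1.
Proof.
move=> eb; have bp := beta_ltp; have b0 : beta != 0 by lia.
pose w := X e.+1 p * c ^+ alpha * X (p - beta + 1) (p - beta + e - 1).
have wl : X e e * w = c ^+ alpha.+1.
  by rewrite -(@torus_power e) // /w ?mulgA ?X_cat //; lia.
have wr : w * X (p - beta + e) (p - beta + e) = c ^+ alpha.+1.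
  have eb' : (1 <= e.+1 <= beta.+1)%N by lia.
  rewrite -(torus_power b0 eb') /w -!mulgA; congr (_ * (_ * _)).
  have -> : (p - beta + e.+1 - 1 = p - beta + e)%N by lia.
  have {2}-> : (p - beta + e = (p - beta + e - 1).+1)%N by lia.
  by rewrite X_cat //; lia.
by rewrite -{1}wl -mulgA wr.
Qed.

(** This puts together [torus_shift] and [torus_wrap], according to whether
    [i + beta] exceeds [p]; the larger exponent of [c] in the second case is the
    carry in the division of [i + q] by [p]. *)
Lemma torus_step (i : nat) : (i < p)%N ->
  c ^+ ((i + q) %/ p) * X i.+1 i.+1 =
  X ((i + q) %% p).+1 ((i + q) %% p).+1 * c ^+ ((i + q) %/ p).
Proof.
move=> ip; have bp := beta_ltp; have [ib|ib] := ltnP i (p - beta).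
  have [-> ->] : ((i + q) %/ p = alpha /\ (i + q) %% p = beta + i)%N.
    have -> : (i + q = alpha * p + (beta + i))%N.
      by rewrite {1}(divn_eq q p) addnC -addnA.
    have small : (beta + i < p)%N by lia.
    by rewrite divnMDl // modnMDl (divn_small small) (modn_small small) addn0.
  by rewrite torus_shift ?addnS //; lia.
have [-> ->] : ((i + q) %/ p = alpha.+1 /\ (i + q) %% p = i - (p - beta))%N.
  have -> : (i + q = alpha.+1 * p + (i - (p - beta)))%N.
    by rewrite mulSn {1}(divn_eq q p); move: (alpha * p)%N => k; lia.
  have small : (i - (p - beta) < p)%N by lia.
  by rewrite divnMDl // modnMDl (divn_small small) (modn_small small) addn0.
rewrite -torus_wrap; last by lia.
by congr (_ * X _ _); lia.
Qed.

Lemma torus_iter (i t : nat) : (i < p)%N ->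
  c ^+ ((i + t * q) %/ p) * X i.+1 i.+1 =
  X ((i + t * q) %% p).+1 ((i + t * q) %% p).+1 * c ^+ ((i + t * q) %/ p).
Proof.
move=> ip; elim: t => [|t IHt].
  by rewrite mul0n addn0 divn_small // modn_small // mul1g mulg1.
set n := (i + t * q)%N in IHt.
have -> : (i + t.+1 * q = n %/ p * p + (n %% p + q))%N.
  by rewrite addnA -divn_eq /n mulSn; lia.
rewrite divnMDl // modnMDl (addnC (n %/ p)) expgnDr -mulgA IHt mulgA torus_step ?ltn_mod //.
by rewrite -mulgA.
Qed.

Local Notation Delta := (c ^+ (q %/ gcdn p q)).

(** After [p / gcd(p, q)] steps the permutation is the identity. *)
Lemma torus_Delta_letter (i : 'I_p) : commute Delta (X i.+1 i.+1).
Proof.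
have ip := ltn_ord i; have := torus_iter (p %/ gcdn p q) ip.
have -> : (p %/ gcdn p q * q = q %/ gcdn p q * p)%N.
  by rewrite [RHS]mulnC muln_divCA_gcd mulnC.
by rewrite addnC divnMDl // modnMDl (divn_small ip) (modn_small ip) addn0.
Qed.

Lemma torus_Delta_central (a : M) : commute Delta a.
Proof.
have [u ->] := pres_classP a; elim: u => [|i u IHu]; first exact: commute1.
by rewrite pres_class_cons; apply: commuteM => //;
  rewrite -xword_letter; apply: torus_Delta_letter.
Qed.

(** Reading words backwards exchanges left and right in the relations, up to the
    relabelling [x_i -> x_{p+1-i}]; the image of the relation for [e <= beta] is
    the one for [beta + 2 - e], once [c^alpha] has been moved across
    [x_1 ... x_{p-beta}]. *)
Lemma torus_flip_rel w w' : R w w' ->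
  pres_cong R (rev (map (@rev_ord p) w)) (rev (map (@rev_ord p) w')).
Proof.
move=> /torus_relP[e ep [-> ->]]; have bp := beta_ltp.
have flipc : rev (map (@rev_ord p) (W 1 p)) = W 1 p.
  by rewrite xword_flip // subSnn subn1.
apply/pres_class_eq; rewrite /torus_lhs /torus_rhs.
have [b0|b0] := eqVneq beta 0.
  rewrite cats0 !word_exp_flip map_cat rev_cat flipc !xword_flip; try by lia.
  rewrite !pres_class_word_exp pres_classM -(@torus_dvd (p.+2 - e)) //; last by lia.
  by congr ((X _ _ * X _ _) ^+ _); lia.
case: leqP => eb; rewrite !map_cat !rev_cat !word_exp_flip flipc !xword_flip;
  try by lia.
  rewrite !pres_classM !pres_class_word_exp -expgS.
  rewrite -(@torus_power (beta.+2 - e)) //; last by lia.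
  have -> : X (beta.+2 - e) p = X (beta.+2 - e) beta * X beta.+1 p.
    by rewrite X_cat //; lia.
  have -> : X (p.+1 - p) (p.+1 - e) = X 1 (p - beta) * X (p - beta).+1 (p.+1 - e).
    by rewrite X_cat; [congr (X _ _) | |]; lia.
  have -> : X beta.+1 p = X beta.+1 (beta + (p - beta)) by congr (X _ _); lia.
  rewrite -!mulgA (mulgA (X beta.+1 _)) -torus_shift_range // -!mulgA.
  by congr (X _ _ * (_ * (_ * X _ _))); lia.
rewrite !pres_classM !pres_class_word_exp.
have -> : (p.+1 - (e - beta) = beta + (p.+1 - e))%N by lia.
by rewrite torus_shift //; lia.
Qed.

Lemma torus_flip : exists rho : M -> M,
  (forall a b, rho (a * b) = rho b * rho a) /\ involutive rho.
Proof. exact: pres_flip (@rev_ordK p) torus_flip_rel. Qed.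

(** * Lcms of the generators *)

Local Notation L e := (pres_class R (torus_lhs e) : M).

Lemma L_lcm e : (2 <= e <= p)%N -> is_right_lcm (L e) (X 1 1) (X e e).
Proof.
move=> ep; have [|i def_e] := @letter_of_index p e; first by lia.
rewrite {e}def_e in ep *; rewrite xword_letter (@xword_letter p x1).
have [|v def_v] := @torus_rhs_head i; first by lia.
have [u def_u] := torus_lhs_head i.+1; rewrite def_u.
apply: (star_right_lcm torus_star (v := v)); rewrite -def_u -def_v.
by apply/torus_relP; exists i.+1.
Qed.

Lemma L_eq e : L e = c ^+ alpha *
  (if beta == 0 then 1 else if (e <= beta)%N then c else X (e - beta) (e - beta)).
Proof.
rewrite /torus_lhs pres_classM pres_class_word_exp.
by case: ifP => // _; case: ifP.
Qed.

Lemma c_divides_L e : left_divisor c (L e).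
Proof.
rewrite L_eq -(prednK alpha_gt0) expgS -mulgA; exact: left_divisor_mulr.
Qed.

(** All common multiples of two distinct generators are multiples of [x_1], so
    the lcm of [x_i] and [x_j] is that of [L i] and [L j]. *)
Lemma lcm_via_L i j d : (2 <= i <= p)%N -> (2 <= j <= p)%N -> i != j ->
  is_right_lcm d (L i) (L j) -> is_right_lcm d (X i i) (X j j).
Proof.
move=> ip jp nij; apply: is_right_lcm_eqv => m.
have [[x1i xi lub_i] [x1j xj lub_j]] := (L_lcm ip, L_lcm jp).
split=> -[im jm].
  by split; [apply: left_divisor_trans im | apply: left_divisor_trans jm].
have x1m : left_divisor (X 1 1) m; last by split; [apply: lub_i | apply: lub_j].
have [|k def_i] := @letter_of_index p i; first by lia.
have [|l def_j] := @letter_of_index p j; first by lia.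
move: im jm nij; rewrite def_i def_j !xword_letter (@xword_letter p x1) eqSS.
by move=> im jm nkl; apply: star_common_multiple im jm => //; apply: torus_star.
Qed.

(** Factoring out [c^alpha] reduces the lcm of [L i] and [L j] to that of
    [x_{i-beta}] and [x_{j-beta}] if [beta < i], and to that of [c] and
    [x_{j-beta}] if [i <= beta < j]. As [c] is a multiple of [x_1] that divides
    [L (j - beta)], the latter is [L (j - beta)], or [c] if [j - beta = 1]. *)
Lemma torus_lcm_lt (i j : nat) : (1 <= i < j)%N -> (j <= p)%N ->
  exists d, is_right_lcm d (X i i) (X j j).
Proof.
have canM := torus_left_cancellative.
have [n] := ubnP i; elim: n i j => // n IHn i j ltin ij jp.
have [-> | i1] := eqVneq i 1%N; first by exists (L j); apply: L_lcm; lia.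
suff [d lcm_d] : exists d, is_right_lcm d (L i) (L j).
  by exists d; apply: lcm_via_L lcm_d; lia.
rewrite !L_eq; have [b0|b0] := eqVneq beta 0.
  by exists (c ^+ alpha * 1); apply: right_lcm_divisor; exact: left_divisor_refl.
suff [d lcm_d] : exists d, is_right_lcm d
    (if (i <= beta)%N then c else X (i - beta) (i - beta))
    (if (j <= beta)%N then c else X (j - beta) (j - beta)).
  by exists (c ^+ alpha * d); apply: right_lcm_mul2l.
case: (leqP i beta) => ib; case: (leqP j beta) => jb.
- by exists c; apply: right_lcm_divisor; exact: left_divisor_refl.
- have [-> | jb1] := eqVneq (j - beta)%N 1%N.
    exists c; apply/is_right_lcmC/right_lcm_divisor.
    by exists (X 2 p); rewrite X_cat //; lia.
  have jbp : (2 <= j - beta <= p)%N by lia.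
  exists (L (j - beta)); have [x1j xj lub] := L_lcm jbp.
  split=> // [|m cm jm]; first exact: c_divides_L.
  apply: lub => //; apply: left_divisor_trans cm.
  by exists (X 2 p); rewrite X_cat //; lia.
- by lia.
by apply: IHn; lia.
Qed.

Lemma torus_lcm_gen (i j : 'I_p) :
  exists d, is_right_lcm d (pres_class R [:: i] : M) (pres_class R [:: j]).
Proof.
rewrite -!xword_letter; have [eq_ij|nij] := eqVneq (i : nat) j.
  by exists (X i.+1 i.+1); rewrite eq_ij; apply/right_lcm_divisor/left_divisor_refl.
wlog lt_ij : i j nij / (i < j)%N => [IH|].
  case: (ltngtP i j) => // [lt_ij|lt_ji|/eqP]; first exact: IH.
    have [|d lcm_d] := IH j i _ lt_ji; first by rewrite eq_sym.
    by exists d; apply: is_right_lcmC.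
  by rewrite (negPf nij).
by apply: torus_lcm_lt => //; exact: ltn_ord.
Qed.

(** * The Garside structure *)

Lemma torus_letter_Delta (i : 'I_p) :
  left_divisor (pres_class R [:: i] : M) Delta.
Proof.
have ip := ltn_ord i; rewrite -xword_letter.
have n_gt0 : (0 < q %/ gcdn p q)%N.
  by rewrite divn_gt0 ?gcdn_gt0 ?p_gt0 // dvdn_leq ?dvdn_gcdr //; lia.
(* [Delta = (x_1 ... x_i) (x_{i+1} ...)], and [Delta] is central. *)
exists (X i.+2 p * c ^+ (q %/ gcdn p q).-1 * X 1 i); rewrite !mulgA.
apply: central_mulC torus_left_cancellative torus_Delta_central _.
by rewrite -{1}(prednK n_gt0) expgS !mulgA !X_cat //; lia.
Qed.

Lemma torus_Delta_garside : garside_element (Delta : M).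
Proof.
split=> [a|a].
  exact: central_divisorC torus_left_cancellative torus_Delta_central.
have [u ->] := pres_classP a.
exists [seq pres_class R [:: i] | i <- u].
  by move=> _ /mapP[i _ ->]; apply: torus_letter_Delta.
by rewrite big_map; apply: pres_class_prod.
Qed.

(** The letters divide [Delta] and [Delta] is central. *)
Lemma torus_divides_Delta_pow (a : M) :
  exists n, left_divisor a (Delta ^+ n).
Proof.
have [u ->] := pres_classP a; elim: u => [|i u [n [e def_e]]].
  by exists 0, 1; rewrite mulg1.
have [d def_d] := torus_letter_Delta i; exists n.+1, (e * d).
have cen : commute (Delta ^+ n) (pres_class R [:: i]).
  exact/commute_sym/commuteX/commute_sym/torus_Delta_central.
rewrite pres_class_cons mulgA -(mulgA _ _ e) -def_e -cen -mulgA -def_d.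
by rewrite expgSr.
Qed.

Lemma torus_right_lcm (a b : M) : exists d, is_right_lcm d a b.
Proof.
have [n an] := torus_divides_Delta_pow a.
have [k [e def_e]] := torus_divides_Delta_pow b.
apply: (@right_lcm_from_atoms M (@pres_length _ R)
  (fun s => exists i, s = pres_class R [:: i]) _ _ _ _ (Delta ^+ (n + k))).
- exact: pres_lengthM (star_size torus_star).
- exact: pres_head_split (star_size torus_star).
- exact: torus_left_cancellative.
- by move=> _ _ [i ->] [j ->]; apply: torus_lcm_gen.
- by rewrite expgnDr; apply: left_divisor_trans an _; apply: left_divisor_mulr.
by exists (e * Delta ^+ n); rewrite mulgA -def_e -expgnDr addnC.
Qed.

Lemma torus_garside_monoid : garside_monoid M.
Proof.
have canM := torus_left_cancellative; have [rho [rhoM rhoK]] := torus_flip.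
split=> //.
- exact: pres_conical (star_size torus_star).
- exact: flip_right_cancellative rhoM rhoK canM.
- move=> a b; have [d lcm_d] := torus_right_lcm (rho a) (rho b).
  by exists (rho d); apply: (flip_left_lcm rhoM rhoK); rewrite rhoK.
- exact: torus_right_lcm.
by exists Delta; apply: torus_Delta_garside.
Qed.

Lemma prod_torus_gen : \prod_(i < p) torus_gen q i = c.
Proof. by rewrite pres_class_prod xword_all enumT. Qed.

End Torus.

Theorem proposition3p1 (p q : nat) (hp : (2 <= p)%N) (hpq : (p <= q)%N) :
  garside_monoid (torus_monoid p q) /\
  garside_element ((\prod_(i < p) torus_gen q i) ^+ (q %/ gcdn p q)).
Proof.
split; first exact: torus_garside_monoid.
by rewrite prod_torus_gen; apply: torus_Delta_garside.
Qed.
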